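(* Let $N\in\mathbb{N}$, let $\bm P$ be the transition probability matrix of a discrete-time birth-death chain on the spider $\mathbb{S}_N$ with $N$ legs, and let $H_m$, $m=1,\ldots,N$, be the continued fractions $$H_m=\cfrac{\alpha_m}{1-\cfrac{c_{1,m}}{1-\cfrac{a_{1,m}}{1-\cfrac{c_{2,m}}{1-\cdots}}}},$$ with sequences of convergents $h_{n,m}=A_{n,m}/B_{n,m}$, $n\ge 0$ (with $A_{n,m},B_{n,m}$ as defined in the context). Assume that $$0<A_{n,m}<B_{n,m},\qquad n\ge1,\quad m=1,\ldots,N.$$ Then the continued fractions $H_m$, $m=1,\ldots,N$, are all convergent (and $H_m$ also denotes the value). Moreover, let $\bm P=\bm P_R\bm P_A$ be a factorization of the reflecting-absorbing form described in the context, with free parameters $\beta_1,\ldots,\beta_N$, and assume that $\sum_{m=1}^N H_m<1$. Then $\bm P_R$ and $\bm P_A$ are stochastic matrices if and only if $$\beta_m\ge H_m,\qquad m=1,2,\ldots,N.$$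
   Context: **Birth-death chain on a spider.** For $N\in\mathbb{N}$ let $\mathbb{S}_N=\{v_N(k,m): k\in\mathbb{N}_0,\ m=1,\ldots,N\}$ with $v_N(k,m)=k\exp(2\pi i(m-1)/N)$; the point $v_N(0):=v_N(0,m)$ (the same for all $m$) is the body of the spider and $N$ is the number of legs. A homogeneous discrete-time birth-death chain $\{S_n\}$ on $\mathbb{S}_N$ is a Markov chain with transition probabilities: from $v_N(0)$ to $v_N(0)$ with probability $\alpha_0$ and from $v_N(0)$ to $v_N(1,m)$ with probability $\alpha_m$, $m=1,\ldots,N$, where $\sum_{m=0}^N\alpha_m=1$; and, for $k\ge1$ and $m=1,\ldots,N$, from $v_N(k,m)$ to $v_N(k+1,m)$, $v_N(k,m)$, $v_N(k-1,m)$ with probabilities $a_{k,m}$, $b_{k,m}$, $c_{k,m}$ respectively, where $a_{k,m}+b_{k,m}+c_{k,m}=1$. It is assumed that $\alpha_m>0$ ($m=1,\ldots,N$), $a_{k,m}>0$, $c_{k,m}>0$, and $\alpha_0\ge 0$, $b_{k,m}\geq 0$. **Transition matrix.** Label the states so that $v_N(0)$ is $0$, the points $v_N(1,1),\ldots,v_N(1,N)$ are $1,\ldots,N$, the points $v_N(2,1),\ldots,v_N(2,N)$ are $N+1,\ldots,2N$, and so on. Grouping the states in blocks of $N$ consecutive labels, the transition matrix is $$\bm P=\begin{pmatrix}\bm B_0&\bm A_0&&&\\ \bm C_1&\bm B_1&\bm A_1&&\\ &\bm C_2&\bm B_2&\bm A_2&\\ &&\ddots&\ddots&\ddots\end{pmatrix},$$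 where $$\bm B_0=\begin{pmatrix}\alpha_0&\alpha_1&\alpha_2&\cdots&\alpha_{N-1}\\ c_{1,1}&b_{1,1}&0&\cdots&0\\ c_{1,2}&0&b_{1,2}&\cdots&0\\ \vdots&\vdots&\vdots&\ddots&\vdots\\ c_{1,N-1}&0&0&\cdots&b_{1,N-1}\end{pmatrix},\quad \bm A_0=\mathrm{diag}(\alpha_N,a_{1,1},\ldots,a_{1,N-1}),$$ and for $n\ge1$ $$\bm A_n=\mathrm{diag}(a_{n,N},a_{n+1,1},\ldots,a_{n+1,N-1}),\quad \bm B_n=\mathrm{diag}(b_{n,N},b_{n+1,1},\ldots,b_{n+1,N-1}),\quad \bm C_n=\mathrm{diag}(c_{n,N},c_{n+1,1},\ldots,c_{n+1,N-1}).$$ **Convergents.** For each $m=1,\ldots,N$, with the convention $a_{0,m}=\alpha_m$, the scalar sequences $(A_{n,m})_{n\ge -1}$ and $(B_{n,m})_{n\ge-1}$ are defined by $$A_{2n,m}=A_{2n-1,m}-c_{n,m}A_{2n-2,m}\ (n\ge1),\quad A_{2n+1,m}=A_{2n,m}-a_{n,m}A_{2n-1,m}\ (n\ge0),\quad A_{-1,m}=-1,\ A_{0,m}=0,$$ $$B_{2n,m}=B_{2n-1,m}-c_{n,m}B_{2n-2,m}\ (n\ge1),\quad B_{2n+1,m}=B_{2n,m}-a_{n,m}B_{2n-1,m}\ (n\ge0),\quad B_{-1,m}=0,\ B_{0,m}=1.$$ The continued fraction $H_m$ is convergent if $\lim_{n\to\infty}h_{n,m}$ exists (finite); the limit is its value.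 **Reflecting-absorbing factorization.** This is a factorization $\bm P=\bm P_R\bm P_A$ with $$\bm P_R=\begin{pmatrix}\bm Y_0&\bm X_0&&\\ &\bm Y_1&\bm X_1&\\ &&\ddots&\ddots\end{pmatrix},\qquad \bm P_A=\begin{pmatrix}\bm S_0&&\\ \bm R_1&\bm S_1&\\ &\ddots&\ddots\end{pmatrix},$$ $$\bm Y_0=\begin{pmatrix}\beta_0&\beta_1&\beta_2&\cdots&\beta_{N-1}\\ 0&y_{1,1}&0&\cdots&0\\ 0&0&y_{1,2}&\cdots&0\\ \vdots&\vdots&\vdots&\ddots&\vdots\\ 0&0&0&\cdots&y_{1,N-1}\end{pmatrix},\qquad \bm S_0=\begin{pmatrix}1&0&0&\cdots&0\\ r_{1,1}&s_{1,1}&0&\cdots&0\\ r_{1,2}&0&s_{1,2}&\cdots&0\\ \vdots&\vdots&\vdots&\ddots&\vdots\\ r_{1,N-1}&0&0&\cdots&s_{1,N-1}\end{pmatrix},$$ $\bm X_0=\mathrm{diag}(\beta_N,x_{1,1},\ldots,x_{1,N-1})$, and for $n\ge1$ $$\bm Y_n=\mathrm{diag}(y_{n,N},y_{n+1,1},\ldots,y_{n+1,N-1}),\quad \bm X_n=\mathrm{diag}(x_{n,N},x_{n+1,1},\ldots,x_{n+1,N-1}),$$ $$\bm S_n=\mathrm{diag}(s_{n,N},s_{n+1,1},\ldots,s_{n+1,N-1}),\quad \bm R_n=\mathrm{diag}(r_{n,N},r_{n+1,1},\ldots,r_{n+1,N-1}),$$ where all entries are real and the rows sum to one: $\sum_{k=0}^N\beta_k=1$,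 $x_{n,m}+y_{n,m}=1$ and $r_{n,m}+s_{n,m}=1$ for all $n\ge1$, $m=1,\ldots,N$. The numbers $\beta_1,\ldots,\beta_N$ are the free parameters of the factorization: all the coefficients $x_{n,m},y_{n,m},r_{n,m},s_{n,m}$ are determined recursively by them from the relations $\alpha_m=\beta_m s_{1,m}$, $c_{n,m}=y_{n,m}r_{n,m}$, $a_{n,m}=x_{n,m}s_{n+1,m}$ and the row-sum conditions. A matrix is stochastic if all its entries are nonnegative and each row sums to one.
   Formalization: The condition that β_1+...+β_N ≤ 1 (i.e. β_0 ≥ 0) is added beside β_m ≥ H_m in the equivalence, since without it the claim fails: N=1, α_1=a=c=1/4, b=1/2, β_1=2 gives β_0=-1. *)

(* Defs.v *)
From HB Require Import structures.
From mathcomp Require Import all_boot all_order all_algebra.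
From mathcomp Require Import all_classical all_reals all_analysis.

Set Implicit Arguments.
Unset Strict Implicit.
Unset Printing Implicit Defensive.

Import Order.TTheory GRing.Theory Num.Theory.
Import numFieldNormedType.Exports.

Local Open Scope classical_set_scope.
Local Open Scope ring_scope.

(* Legs are numbered by the naturals 1, ..., N and a site on a leg by its
   distance k >= 1 to the body; a coefficient such as a_{k,m} is [a k m].
   Apart from alpha_0 and beta_0, values outside these ranges are never used. *)
Section Spider.
Variable R : realType.

(* Transition probabilities of a birth-death chain on the spider with N legs:
   from the body, [alpha 0] to stay and [alpha m] to enter leg m; on leg m at
   distance k, [a k m] outwards, [b k m] to stay and [c k m] inwards. *)
Record spider_chain (N : nat) (alpha : nat -> R) (a b c : nat -> nat -> R)
    : Prop := SpiderChain {
  alpha_sum : \sum_(0 <= m < N.+1) alpha m = 1;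
  alpha0_ge0 : 0 <= alpha 0%N;
  alpha_gt0 : forall m, (1 <= m <= N)%N -> 0 < alpha m;
  abc_sum : forall k m, (1 <= k)%N -> (1 <= m <= N)%N ->
    a k m + b k m + c k m = 1;
  a_gt0 : forall k m, (1 <= k)%N -> (1 <= m <= N)%N -> 0 < a k m;
  b_ge0 : forall k m, (1 <= k)%N -> (1 <= m <= N)%N -> 0 <= b k m;
  c_gt0 : forall k m, (1 <= k)%N -> (1 <= m <= N)%N -> 0 < c k m
}.

(* The convention f_{0,m} = w_m, as in a_{0,m} = alpha_m. *)
Definition ext0 (w : nat -> R) (f : nat -> nat -> R) : nat -> nat -> R :=
  fun k m => if k == 0%N then w m else f k m.

(* Infinite matrices are partitioned in N x N blocks: [M i j] is the block in
   block row i and block column j, so that [M i j k l] is the entry for the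
   states with labels i * N + k and j * N + l. *)
Definition bmatrix (N : nat) := nat -> nat -> 'M[R]_N.

(* The sum has finite support as soon as one factor is banded. *)
Definition bmulmx N (M M' : bmatrix N) : bmatrix N :=
  fun i j => \sum_(k \in [set: nat]) (M i k *m M' k j).

Definition stochastic N (M : bmatrix N) : Prop :=
  (forall i j k l, 0 <= M i j k l) /\
  (forall i k, series (fun j => \sum_(l < N) M i j k l) @ \oo --> (1 : R)).

(* Diagonal blocks D, superdiagonal blocks U (U i at (i, i + 1)) and
   subdiagonal blocks L (L i at (i, i - 1)). *)
Definition tridiag_bmx N (D U L : nat -> 'M[R]_N) : bmatrix N := fun i j =>
  if j == i then D i else if j == i.+1 then U i
  else if i == j.+1 then L i else 0.

(* diag(f_{n,N}, f_{n+1,1}, ..., f_{n+1,N-1}) *)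
Definition leg_diag N (f : nat -> nat -> R) (n : nat) : 'M[R]_N :=
  diag_mx (\row_(j < N) if j == 0%N :> nat then f n N else f n.+1 j).

(* First row w_0, ..., w_{N-1}, rest of the first column u_1, ..., u_{N-1},
   rest of the diagonal v_1, ..., v_{N-1}. *)
Definition hub_mx N (w u v : nat -> R) : 'M[R]_N :=
  \matrix_(i < N, j < N)
    if i == 0%N :> nat then w j
    else if j == 0%N :> nat then u i
    else if i == j then v i else 0.

Definition spider_mx N (alpha : nat -> R) (a b c : nat -> nat -> R) :
    bmatrix N :=
  tridiag_bmx
    (fun n => if n == 0%N then hub_mx N alpha (c 1%N) (b 1%N)
              else leg_diag N b n)
    (leg_diag N (ext0 alpha a))
    (leg_diag N c).

Definition reflecting_mx N (beta : nat -> R) (x y : nat -> nat -> R) :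
    bmatrix N :=
  tridiag_bmx
    (fun n => if n == 0%N then hub_mx N beta (fun=> 0) (y 1%N)
              else leg_diag N y n)
    (leg_diag N (ext0 beta x))
    (fun=> 0).

Definition absorbing_mx N (r s : nat -> nat -> R) : bmatrix N :=
  tridiag_bmx
    (fun n => if n == 0%N
              then hub_mx N (fun l => (l == 0%N)%:R) (r 1%N) (s 1%N)
              else leg_diag N s n)
    (fun=> 0)
    (leg_diag N r).

Record RA_factorization (N : nat) (P : bmatrix N)
    (beta : nat -> R) (x y r s : nat -> nat -> R) : Prop := RAFactorization {
  beta_sum : \sum_(0 <= k < N.+1) beta k = 1;
  xy_sum : forall n m, (1 <= n)%N -> (1 <= m <= N)%N -> x n m + y n m = 1;
  rs_sum : forall n m, (1 <= n)%N -> (1 <= m <= N)%N -> r n m + s n m = 1;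
  RA_mul : P =2 bmulmx (reflecting_mx N beta x y) (absorbing_mx N r s)
}.

(* Pair (u_{n-1}, u_n) for u_n = u_{n-1} - d_n u_{n-2}, n >= 1, started at
   (u_{-1}, u_0) = [p]. *)
Fixpoint rec_pair (d : nat -> R) (p : R * R) (n : nat) : R * R :=
  if n is n'.+1 then
    let q := rec_pair d p n' in (q.2, q.2 - d n * q.1)
  else p.

(* d_{2n} = c_{n,m} (n >= 1) and d_{2n+1} = a_{n,m} (n >= 0) *)
Definition cf_coef (alpha : nat -> R) (a c : nat -> nat -> R) (m n : nat) : R :=
  if odd n then ext0 alpha a n./2 m else c n./2 m.

(* A_{n,m} *)
Definition cf_num alpha a c (n m : nat) : R :=
  (rec_pair (cf_coef alpha a c m) (-1, 0) n).2.

(* B_{n,m} *)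
Definition cf_den alpha a c (n m : nat) : R :=
  (rec_pair (cf_coef alpha a c m) (0, 1) n).2.

(* The sequence (h_{n,m})_n of convergents of H_m. *)
Definition cf_convergent alpha a c (m : nat) : R^nat :=
  fun n => cf_num alpha a c n m / cf_den alpha a c n m.

(* The value H_m, meaningful when the convergents converge. *)
Definition cf_value alpha a c (m : nat) : R :=
  limn (cf_convergent alpha a c m).

End Spider.

(* Main.v *)
Require Import Defs.
From HB Require Import structures.
From mathcomp Require Import all_boot all_order all_algebra.
From mathcomp Require Import all_classical all_reals all_analysis.
From mathcomp Require Import ring lra zify.

Import Order.TTheory GRing.Theory Num.Theory.
Import numFieldNormedType.Exports.

Local Open Scope classical_set_scope.
Local Open Scope ring_scope.

(** The coefficients of a reflecting-absorbing factorization are bound, on each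
    leg m, by beta_m s_1 = alpha_m, y_n r_n = c_n and x_n s_{n+1} = a_n.
    Eliminating s and y through the row sums, the interleaved sequence
    t = (beta_m, r_1, x_1, r_2, x_2, ...) satisfies
    t_n (1 - t_{n+1}) = d_{n+1}, where d = (alpha_m, c_1, a_1, c_2, ...) lists
    the partial numerators of H_m.  This first-order recursion is linearized
    by u_n = beta_m B_n - A_n: this sequence obeys the same three-term
    recursion as A_n and B_n, starts at u_{-1} = 1 and u_0 = t_0, and its
    successive ratios are u_n / u_{n-1} = t_n, so that u_n = t_0 ... t_n
    ([rec_pair_ratio]).  Therefore all the t_n are positive if and only if
    A_n / B_n < beta_m for every n.

    The determinant A_n B_{n-1} - A_{n-1} B_n is the product d_1 ... d_n > 0,
    so the convergents increase strictly; being below 1 they converge, and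
    they are all below beta_m exactly when their limit H_m is at most beta_m
    ([ratios_gt0P]).

    Finally, stochasticity of both factors amounts to beta_0 >= 0 and the
    positivity of all t_n.  Indeed d_{n+1} > 0 forbids t_n = 0 when t_n >= 0,
    and forces t_{n+1} < 1 once t_n > 0, which yields the signs of s and y
    (lemmas [reflecting_stochastic] and [absorbing_stochastic] for the
    matrices). *)

(** * Three-term recursions and convergents *)

(** The recursion is linear in its initial pair, and
    (1, z) = z (0, 1) - (-1, 0). *)
Lemma rec_pair_lin {R : realType} (d : nat -> R) (z : R) (n : nat) :
  let A := rec_pair d (-1, 0) n in let B := rec_pair d (0, 1) n in
  rec_pair d (1, z) n = (z * B.1 - A.1, z * B.2 - A.2).
Proof.
elim: n => [|n /= ->] /=; first by congr pair; ring.
by congr pair; ring.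
Qed.

(** In each step the part of the 2 x 2 determinant without d cancels, which
    leaves the previous determinant multiplied by d_{n+1}. *)
Lemma rec_pair_det {R : realType} (d : nat -> R) (n : nat) :
  let A := rec_pair d (-1, 0) n in let B := rec_pair d (0, 1) n in
  A.2 * B.1 - A.1 * B.2 = \prod_(i < n) d i.+1.
Proof.
elim: n => [|n /= IH] /=; first by rewrite big_ord0; ring.
by rewrite big_ord_recr /= -IH; ring.
Qed.

(** Division of the three-term recursion for u by u_{n-1} turns it into
    t_n (1 - t_{n+1}) = d_{n+1} for the ratios. The conclusion is kept in
    product form, so that it also covers sequences with vanishing terms. *)
Lemma rec_pair_ratio {R : realType} (d t : nat -> R) (n : nat) :
  (forall i, t i * (1 - t i.+1) = d i.+1) ->
  let u := rec_pair d (1, t 0%N) n in u.2 = t n * u.1.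
Proof.
move=> td; elim: n => [|n /= IH] /=; first by rewrite mulr1.
by rewrite -td IH; ring.
Qed.

Lemma ratios_gt0_iff {R : realType} {d t : nat -> R} :
  (forall i, t i * (1 - t i.+1) = d i.+1) ->
  (forall n, 0 < t n) <-> (forall n, 0 < (rec_pair d (1, t 0%N) n).2).
Proof.
move=> td; split=> pos n.
- suff: 0 < (rec_pair d (1, t 0%N) n).1 /\ 0 < (rec_pair d (1, t 0%N) n).2.
    by case.
  elim: n => [|n [_ u2]] /=; first by split=> //; exact: ltr01.
  split=> //; move: (rec_pair_ratio d t n.+1 td) => /= ->.
  exact: mulr_gt0.
- have u1 : 0 < (rec_pair d (1, t 0%N) n).1.
    by case: n => [|n] //=; exact: ltr01.
  by move: (pos n); rewrite (rec_pair_ratio d t n td) pmulr_lgt0.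
Qed.

Lemma convergents_lt {R : realType} (d : nat -> R) (n : nat) :
  (forall i, 0 < d i.+1) -> (forall i, 0 < (rec_pair d (0, 1) i).2) ->
  (rec_pair d (-1, 0) n).2 / (rec_pair d (0, 1) n).2 <
  (rec_pair d (-1, 0) n.+1).2 / (rec_pair d (0, 1) n.+1).2.
Proof.
move=> d0 B0; rewrite ltr_pdivrMr // mulrAC ltr_pdivlMr // -subr_gt0.
have := rec_pair_det d n.+1; rewrite /= => ->.
by apply: prodr_gt0.
Qed.

Lemma convergents_cvg {R : realType} (d : nat -> R) :
  (forall i, 0 < d i.+1) -> (forall i, 0 < (rec_pair d (0, 1) i).2) ->
  (forall i, (rec_pair d (-1, 0) i).2 < (rec_pair d (0, 1) i).2) ->
  cvgn (fun n => (rec_pair d (-1, 0) n).2 / (rec_pair d (0, 1) n).2).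
Proof.
move=> d0 B0 AB; apply: nondecreasing_is_cvgn.
  by apply/nondecreasing_seqP => n; apply/ltW/convergents_lt.
by exists 1 => _ [n _ <-]; rewrite ler_pdivrMr // mul1r ltW.
Qed.

(** Positivity of all ratios means that t_0 exceeds every convergent; as the
    convergents increase strictly, this is the same as t_0 being at least
    their limit, the boundary case included. *)
Lemma ratios_gt0P {R : realType} (d t : nat -> R) :
  let h := fun n => (rec_pair d (-1, 0) n).2 / (rec_pair d (0, 1) n).2 in
  (forall i, 0 < d i.+1) -> (forall i, 0 < (rec_pair d (0, 1) i).2) ->
  (forall i, t i * (1 - t i.+1) = d i.+1) -> cvgn h ->
  (forall n, 0 < t n) <-> limn h <= t 0%N.
Proof.
move=> h d0 B0 td hcvg.
have hlt n : h n < h n.+1 by exact: convergents_lt.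
have hle : {homo h : n m / (n <= m)%N >-> n <= m}.
  by apply/nondecreasing_seqP => n; exact/ltW.
have uh n : (0 < (rec_pair d (1, t 0%N) n).2) = (h n < t 0%N).
  by rewrite rec_pair_lin /= subr_gt0 /h ltr_pdivrMr.
split=> [/(ratios_gt0_iff td) u0|ht].
  by apply: limr_le => //; apply: nearW => n; rewrite ltW // -uh.
apply/(ratios_gt0_iff td) => n; rewrite uh.
apply: (lt_le_trans (hlt n)); apply: le_trans ht.
exact: nondecreasing_cvgn_le.
Qed.

(** * Block matrices on the spider *)

(** The state with index k in block i lies on leg [leg_of N k] at distance
    [site_of i k] from the body: index 0 belongs to leg N, whose sites are
    labelled one block later than those of the other legs. *)
Definition leg_of (N k : nat) : nat := if k == 0%N then N else k.
Definition site_of (i k : nat) : nat := if k == 0%N then i else i.+1.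

Lemma leg_of_range (N : nat) (k : 'I_N) : (1 <= leg_of N k <= N)%N.
Proof. by rewrite /leg_of; case: k => k /=; case: eqP; lia. Qed.

Lemma site_ofS (i k : nat) : site_of i.+1 k = (site_of i k).+1.
Proof. by rewrite /site_of; case: eqP. Qed.

Lemma site_leg_surj (N n m : nat) : (1 <= n)%N -> (1 <= m <= N)%N ->
  exists i (k : 'I_N), site_of i k = n /\ leg_of N k = m.
Proof.
move=> n1 m1; have [mN|mN] := eqVneq m N.
  have N0 : (0 < N)%N by lia.
  by exists n, (Ordinal N0); rewrite mN.
have mltN : (m < N)%N by lia.
exists n.-1, (Ordinal mltN); rewrite /site_of /leg_of /=.
by case: eqP; lia.
Qed.

Lemma leg_diagE {R : realType} (N : nat) (f : nat -> nat -> R) (n : nat)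
    (k l : 'I_N) :
  leg_diag N f n k l = if k == l then f (site_of n k) (leg_of N k) else 0.
Proof.
rewrite /leg_diag !mxE /site_of /leg_of.
by case: (k == l); rewrite ?mulr1n ?mulr0n //; case: eqP => // ->.
Qed.

Lemma leg_diag_row_sum {R : realType} (N : nat) (f : nat -> nat -> R) (n : nat)
    (k : 'I_N) :
  \sum_(l < N) leg_diag N f n k l = f (site_of n k) (leg_of N k).
Proof.
rewrite (bigD1 k) //= leg_diagE eqxx big1 ?addr0 // => l lk.
by rewrite leg_diagE eq_sym (negPf lk).
Qed.

Lemma leg_diag_mul {R : realType} (N : nat) (f g : nat -> nat -> R) (i j : nat)
    (k : 'I_N) :
  (leg_diag N f i *m leg_diag N g j) k k =
  f (site_of i k) (leg_of N k) * g (site_of j k) (leg_of N k).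
Proof.
rewrite mxE (bigD1 k) //= !leg_diagE eqxx big1 ?addr0 // => l lk.
by rewrite !leg_diagE eq_sym (negPf lk) mul0r.
Qed.

Lemma hub_row_sum {R : realType} (N : nat) (w u v : nat -> R) (k : 'I_N) :
  \sum_(l < N) hub_mx N w u v k l =
  if k == 0%N :> nat then \sum_(l < N) w l else u k + v k.
Proof.
case: eqP => k0; first by apply: eq_bigr => l _; rewrite mxE k0.
case: N k k0 => [[]//|N] k /eqP k0.
rewrite (bigD1 ord0) //= (bigD1 k) /=; last by rewrite -val_eqE.
rewrite !mxE (negPf k0) !eqxx big1 ?addr0 // => l /andP[l0 lk].
by rewrite !mxE (negPf k0) (negPf (l0 : l != 0%N :> nat)) eq_sym (negPf lk).
Qed.

Lemma hub_mul_row0 {R : realType} (N : nat) (w v u' v' : nat -> R)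
    (o l : 'I_N) : o = 0%N :> nat -> l != 0%N :> nat ->
  (hub_mx N w (fun=> 0) v *m hub_mx N (fun j => (j == 0%N)%:R) u' v') o l =
  w l * v' l.
Proof.
move=> o0 l0; rewrite mxE (bigD1 l) //= !mxE o0 !eqxx (negPf l0) big1.
  by rewrite addr0.
move=> j jl; rewrite !mxE o0 eqxx (negPf l0) (negPf jl).
by case: eqP; rewrite mulr0.
Qed.

Lemma hub_mul_col0 {R : realType} (N : nat) (w v w' u' v' : nat -> R)
    (k o : 'I_N) : o = 0%N :> nat -> k != 0%N :> nat ->
  (hub_mx N w (fun=> 0) v *m hub_mx N w' u' v') k o = v k * u' k.
Proof.
move=> o0 k0; rewrite mxE (bigD1 k) //= !mxE o0 !eqxx (negPf k0) big1.
  by rewrite addr0.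
move=> j jk; rewrite !mxE (negPf k0) (eq_sym k j) (negPf jk).
by case: eqP; rewrite mul0r.
Qed.

Lemma tridiag_diag {R : realType} (N : nat) (D U L : nat -> 'M[R]_N) i :
  tridiag_bmx D U L i i = D i.
Proof. by rewrite /tridiag_bmx eqxx. Qed.

Lemma tridiag_up {R : realType} (N : nat) (D U L : nat -> 'M[R]_N) i :
  tridiag_bmx D U L i i.+1 = U i.
Proof. by rewrite /tridiag_bmx eqxx; case: eqP => //; lia. Qed.

Lemma tridiag_low {R : realType} (N : nat) (D U L : nat -> 'M[R]_N) i :
  tridiag_bmx D U L i.+1 i = L i.+1.
Proof.
by rewrite /tridiag_bmx eqxx; case: eqP => [|_]; [lia|case: eqP => //; lia].
Qed.

Lemma tridiag_off {R : realType} (N : nat) (D U L : nat -> 'M[R]_N) i j :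
  (i.+1 < j)%N || (j.+1 < i)%N -> tridiag_bmx D U L i j = 0.
Proof.
move=> ij; rewrite /tridiag_bmx.
by do 3 (case: eqP => [?|_]; first by exfalso; lia).
Qed.

Lemma tridiag_ge0 {R : realType} (N : nat) (D U L : nat -> 'M[R]_N) :
  (forall i k l, 0 <= D i k l) -> (forall i k l, 0 <= U i k l) ->
  (forall i k l, 0 <= L i.+1 k l) ->
  forall i j k l, 0 <= tridiag_bmx D U L i j k l.
Proof.
move=> D0 U0 L0 i j k l; rewrite /tridiag_bmx.
case: eqP => // _; case: eqP => // _; case: eqP => [->//|_].
by rewrite mxE.
Qed.

Lemma tridiag_row_cvg {R : realType} (N : nat) (D U L : nat -> 'M[R]_N) i k
    (S : R) :
  \sum_(l < N) D i k l + \sum_(l < N) U i k l +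
    (if i == 0%N then 0 else \sum_(l < N) L i k l) = S ->
  series (fun j => \sum_(l < N) tridiag_bmx D U L i j k l) @ \oo --> S.
Proof.
move=> DULS; apply: cvg_near_cst; exists i.+2 => // n /= n_ge.
have off j : (i.+1 < j)%N || (j.+1 < i)%N ->
    \sum_(l < N) tridiag_bmx D U L i j k l = 0.
  by move=> ij; rewrite tridiag_off //; apply: big1 => l _; rewrite mxE.
have tail : \sum_(i.+2 <= j < n) \sum_(l < N) tridiag_bmx D U L i j k l = 0.
  by rewrite big_nat big1 // => j ji; apply: off; lia.
rewrite /series /= (big_cat_nat (n := i.+2)) //= tail addr0 -DULS.
rewrite big_nat_recr //= tridiag_up big_nat_recr //= tridiag_diag.
case: i {DULS n_ge tail} off => [|i] off /=.
  by rewrite big_geq // add0r addr0.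
rewrite big_nat_recr //= tridiag_low big_nat big1.
  by rewrite add0r -addrA addrC.
by move=> j ji; apply: off; lia.
Qed.

(** When the left factor is upper block bidiagonal, the sum over all blocks
    reduces to two terms. *)
Lemma bmulmx_upper {R : realType} (N : nat) (D U : nat -> 'M[R]_N)
    (M : bmatrix R N) i j :
  bmulmx (tridiag_bmx D U (fun=> 0)) M i j = D i *m M i j + U i *m M i.+1 j.
Proof.
rewrite /bmulmx (fsbigE [:: i; i.+1]) //=.
- rewrite !big_cons big_nil !in_setT addr0 tridiag_diag tridiag_up //.
- by rewrite inE andbT; lia.
move=> k _; rewrite !inE negb_or => /andP[/negPf ki /negPf kSi].
rewrite /tridiag_bmx ki kSi; case: ifP => _; exact: mul0mx.
Qed.

(** * The two factors *)

(** Each relation is read off one entry of P: away from the body, the blocks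
    involved are diagonal. For m < N, the relations next to the body come from
    the first row and column of the corner block instead, because the first
    site of these legs shares its block with the body. *)
Lemma RA_relations {R : realType} {N : nat} {alpha beta : nat -> R}
    {a b c x y r s : nat -> nat -> R} :
  RA_factorization (spider_mx N alpha a b c) beta x y r s ->
  (forall n m, (1 <= m <= N)%N ->
     ext0 beta x n m * s n.+1 m = ext0 alpha a n m) /\
  (forall n m, (1 <= n)%N -> (1 <= m <= N)%N -> y n m * r n m = c n m).
Proof.
move=> [_ _ _ PE].
have up i (k : 'I_N) : ext0 beta x (site_of i k) (leg_of N k) *
    s (site_of i k).+1 (leg_of N k) = ext0 alpha a (site_of i k) (leg_of N k).
  have := congr1 (fun M : matrix R N N => M k k) (PE i i.+1).
  rewrite /= bmulmx_upper /spider_mx /absorbing_mx !tridiag_up tridiag_diag.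
  by rewrite /= mulmx0 add0r leg_diag_mul site_ofS leg_diagE eqxx => ->.
have low i (k : 'I_N) : y (site_of i.+1 k) (leg_of N k) *
    r (site_of i.+1 k) (leg_of N k) = c (site_of i.+1 k) (leg_of N k).
  have := congr1 (fun M : matrix R N N => M k k) (PE i.+1 i).
  rewrite /= bmulmx_upper /spider_mx /absorbing_mx !tridiag_low.
  rewrite tridiag_off ?ltnSn ?orbT // mulmx0 addr0.
  by rewrite /= leg_diag_mul leg_diagE eqxx => ->.
have corner (k l : 'I_N) : k != l ->
    hub_mx N alpha (c 1%N) (b 1%N) k l =
    (hub_mx N beta (fun=> 0) (y 1%N) *m
       hub_mx N (fun j => (j == 0%N)%:R) (r 1%N) (s 1%N)) k l.
  move=> kl; have := congr1 (fun M : matrix R N N => M k l) (PE 0%N 0%N).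
  rewrite /= bmulmx_upper /spider_mx /absorbing_mx !tridiag_diag tridiag_low /=.
  move=> ->; rewrite [LHS]mxE [X in _ + X]mxE [X in _ + X]big1 ?addr0 //.
  move=> j _; rewrite !leg_diagE; case: eqP => [<-|_]; last by rewrite mul0r.
  by rewrite (negPf kl) mulr0.
split=> [n m m1|n m n1 m1].
- have [n0|n0] := posnP n; last first.
    by have [i [k [<- <-]]] := site_leg_surj N n m n0 m1; exact: up.
  have N0 : (0 < N)%N by lia.
  have [->|mN] := eqVneq m N; first by rewrite n0; exact: (up 0%N (Ordinal N0)).
  have mltN : (m < N)%N by lia.
  have m0 : m != 0%N by lia.
  rewrite n0 /ext0 /=; have := corner (Ordinal N0) (Ordinal mltN).
  rewrite hub_mul_row0 // mxE /= => <- //.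
  by rewrite -val_eqE /= eq_sym.
- have [[|i] [k [nE <-]]] := site_leg_surj N n m n1 m1; rewrite -nE; last first.
    exact: low.
  have k0 : k != 0%N :> nat.
    by move: nE n1; rewrite /site_of; case: eqP => // _ <-.
  have N0 : (0 < N)%N by exact: leq_trans (ltn_ord k).
  rewrite /site_of /leg_of (negPf k0); have := corner k (Ordinal N0).
  by rewrite hub_mul_col0 // mxE /= (negPf k0) => <-.
Qed.

(** A row of P_R has two parts, in the diagonal block and in the one to its
    right: on a leg they contribute y and x, and the row of the body carries
    beta_0, ..., beta_{N-1} in the corner and beta_N in the next block. *)
Lemma reflecting_stochastic {R : realType} (N : nat) (beta : nat -> R)
    (x y : nat -> nat -> R) :
  (0 < N)%N -> \sum_(0 <= k < N.+1) beta k = 1 ->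
  (forall n m, (1 <= n)%N -> (1 <= m <= N)%N -> x n m + y n m = 1) ->
  stochastic (reflecting_mx N beta x y) <->
  (forall m, (m <= N)%N -> 0 <= beta m) /\
  (forall n m, (1 <= n)%N -> (1 <= m <= N)%N -> 0 <= x n m /\ 0 <= y n m).
Proof.
move=> N0 beta1 xy1; pose o := Ordinal N0.
split=> [[M0 _]|[beta0 xy0]].
- have up i k := M0 i i.+1 k k; have diag i k l := M0 i i k l.
  split=> [m mN|n m n1 m1].
    have [->|mneN] := eqVneq m N.
      by have := up 0%N o; rewrite /reflecting_mx tridiag_up leg_diagE eqxx.
    have mltN : (m < N)%N by lia.
    have := diag 0%N o (Ordinal mltN).
    by rewrite /reflecting_mx tridiag_diag mxE.
  have [i [k [nE mE]]] := site_leg_surj N n m n1 m1; split.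
    have := up i k; rewrite /reflecting_mx tridiag_up leg_diagE eqxx nE mE.
    by rewrite /ext0; case: eqP n1 => // ->.
  have := diag i k k; rewrite /reflecting_mx tridiag_diag.
  case: eqP => [i0|_]; last by rewrite leg_diagE eqxx nE mE.
  move: nE mE n1; rewrite mxE i0 /site_of /leg_of.
  by case: eqP => [_ <- //|_ <- <- _]; rewrite eqxx.
- have ext_ge0 n m : (1 <= m <= N)%N -> 0 <= ext0 beta x n m.
    move=> m1; rewrite /ext0; case: posnP => n1; last by case: (xy0 n m n1 m1).
    by apply: beta0; lia.
  split=> [|i k].
    apply: tridiag_ge0 => [i k l|i k l|i k l]; last by rewrite mxE.
      case: posnP => i0.
        rewrite mxE; case: eqP => k0; first by apply: beta0; exact: ltnW.
        case: eqP => // _; case: eqP => // _.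
        have k1 : (1 <= k <= N)%N by case: k k0 => k /=; lia.
        by case: (xy0 1%N k isT k1).
      rewrite leg_diagE; case: eqP => // _.
      have i1 : (1 <= site_of i k)%N by rewrite /site_of; case: ifP.
      by case: (xy0 _ _ i1 (leg_of_range N k)).
    by rewrite leg_diagE; case: eqP => // _; exact/ext_ge0/leg_of_range.
  apply: tridiag_row_cvg; rewrite leg_diag_row_sum.
  rewrite [X in _ + _ + X](_ : _ = 0); last first.
    by case: ifP => // _; apply: big1 => l _; rewrite mxE.
  rewrite addr0 /ext0.
  case: (posnP i) => i0.
    rewrite hub_row_sum /site_of /leg_of; case: eqP => k0.
      by rewrite i0 /= -beta1 big_nat_recr //= big_mkord.
    have k1 : (1 <= k <= N)%N by case: k k0 => k /=; lia.
    by rewrite i0 /= add0r addrC xy1.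
  have i1 : (1 <= site_of i k)%N by rewrite /site_of; case: ifP.
  by rewrite leg_diag_row_sum gtn_eqF // addrC xy1 // leg_of_range.
Qed.

(** The body is absorbing: its row is the unit vector, so that only the legs
    give conditions. *)
Lemma absorbing_stochastic {R : realType} (N : nat) (r s : nat -> nat -> R) :
  (0 < N)%N ->
  (forall n m, (1 <= n)%N -> (1 <= m <= N)%N -> r n m + s n m = 1) ->
  stochastic (absorbing_mx N r s) <->
  (forall n m, (1 <= n)%N -> (1 <= m <= N)%N -> 0 <= r n m /\ 0 <= s n m).
Proof.
move=> N0 rs1; pose o := Ordinal N0.
split=> [[M0 _] n m n1 m1|rs0].
- have low i k := M0 i.+1 i k k; have diag i k l := M0 i i k l.
  have [i [k [nE mE]]] := site_leg_surj N n m n1 m1.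
  case: i => [|i] in nE *.
    have k0 : k != 0%N :> nat.
      by move: nE n1; rewrite /site_of; case: eqP => // _ <-.
    move: nE mE; rewrite /site_of /leg_of (negPf k0) => <- <-.
    have := diag 0%N k o; have := diag 0%N k k.
    rewrite /absorbing_mx tridiag_diag !mxE (negPf k0) eqxx /=.
    by move=> ? ?; split.
  rewrite -nE -mE; split.
    by have := low i k; rewrite /absorbing_mx tridiag_low leg_diagE eqxx.
  by have := diag i.+1 k k; rewrite /absorbing_mx tridiag_diag leg_diagE eqxx.
- have hub0 (k : 'I_N) : k <> 0%N :> nat -> (1 <= k <= N)%N.
    by case: k => k /=; lia.
  have site0 i k : (0 < i)%N -> (1 <= site_of i k)%N.
    by rewrite /site_of; case: ifP.
  split=> [|i k].
    apply: tridiag_ge0 => [i k l|i k l|i k l]; first 1 last.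
    + by rewrite mxE.
    + rewrite leg_diagE; case: eqP => // _.
      by case: (rs0 _ _ (site0 i.+1 k isT) (leg_of_range N k)).
    + case: posnP => i0.
        rewrite mxE; case: eqP => [_|/hub0 k1]; first exact: ler0n.
        have [? ?] := rs0 1%N k isT k1.
        by case: eqP => // _; case: eqP.
      rewrite leg_diagE; case: eqP => // _.
      by case: (rs0 _ _ (site0 i k i0) (leg_of_range N k)).
  apply: tridiag_row_cvg; rewrite leg_diag_row_sum.
  rewrite [X in _ + X + _]big1 ?addr0; last by move=> l _; rewrite mxE.
  case: (posnP i) => i0.
    rewrite hub_row_sum addr0; case: eqP => [_|/hub0 k1]; last by rewrite rs1.
    rewrite (bigD1 o) //= big1 ?addr0 // => l.
    by rewrite -val_eqE /= => /negPf ->.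
  by rewrite leg_diag_row_sum addrC rs1 ?site0 // leg_of_range.
Qed.

(** * Signs of the coefficients and values of the continued fractions *)

Theorem theorem3p1 (R : realType) (N : nat) (hN : (0 < N)%N)
    (alpha : nat -> R) (a b c : nat -> nat -> R)
    (hP : spider_chain N alpha a b c)
    (hAB : forall n m, (1 <= n)%N -> (1 <= m <= N)%N ->
      0 < cf_num alpha a c n m < cf_den alpha a c n m) :
  (forall m, (1 <= m <= N)%N -> cvgn (cf_convergent alpha a c m)) /\
  (forall (beta : nat -> R) (x y r s : nat -> nat -> R),
    RA_factorization (spider_mx N alpha a b c) beta x y r s ->
    \sum_(1 <= m < N.+1) cf_value alpha a c m < 1 ->
    (stochastic (reflecting_mx N beta x y) /\ stochastic (absorbing_mx N r s))
    <->
    (\sum_(1 <= m < N.+1) beta m <= 1 /\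
     forall m, (1 <= m <= N)%N -> cf_value alpha a c m <= beta m)).
Proof.
have [_ _ alpha0 _ a0 _ c0] := hP.
have d0 m n : (1 <= m <= N)%N -> 0 < cf_coef alpha a c m n.+1.
  move=> m1; rewrite /cf_coef /ext0 /= uphalf_half.
  case: (boolP (odd n)) => [_|_] /=; first exact: c0.
  by case: posnP => n0; [exact: alpha0|exact: a0].
have B0 m n : (1 <= m <= N)%N -> 0 < cf_den alpha a c n m.
  move=> m1; case: n => [|n]; first exact: ltr01.
  by have /andP[A0 AB] := hAB n.+1 m isT m1; exact: lt_trans AB.
have AB m n : (1 <= m <= N)%N -> cf_num alpha a c n m < cf_den alpha a c n m.
  move=> m1; case: n => [|n]; first exact: ltr01.
  by have /andP[] := hAB n.+1 m isT m1.
have hcvg m : (1 <= m <= N)%N -> cvgn (cf_convergent alpha a c m).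
  move=> m1; apply: convergents_cvg => n; [exact: d0|exact: B0|exact: AB].
split=> // beta x y r s RA _.
have [xs yr] := RA_relations RA; have [beta1 xy1 rs1 _] := RA.
(* t m = (beta_m, r_{1,m}, x_{1,m}, r_{2,m}, ...), beta_m being x_{0,m} *)
pose t m n := if odd n then r n./2.+1 m else ext0 beta x n./2 m.
have td m : (1 <= m <= N)%N ->
    forall n, t m n * (1 - t m n.+1) = cf_coef alpha a c m n.+1.
  move=> m1 n; rewrite /t /cf_coef /= uphalf_half.
  case: (boolP (odd n)) => _ /=.
    by rewrite -yr // -(xy1 n./2.+1 m) // /ext0 /=; ring.
  by rewrite -xs // -(rs1 n./2.+1 m) //; ring.
have tP m : (1 <= m <= N)%N ->
    (forall n, 0 < t m n) <-> cf_value alpha a c m <= beta m.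
  by move=> m1; apply: ratios_gt0P;
    [move=> n; exact: d0|move=> n; exact: B0|exact: td|exact: hcvg].
have beta0E : beta 0%N = 1 - \sum_(1 <= m < N.+1) beta m.
  by rewrite -beta1 big_nat_recl //= big_add1 /=; ring.
rewrite reflecting_stochastic // absorbing_stochastic //.
split=> [[[beta0 xy0] rs0]|[betale1 Hbeta]].
- split=> [|m m1]; first by have := beta0 0%N isT; lra.
  apply/(tP m m1) => n.
  have t_ge0 : 0 <= t m n.
    rewrite /t /ext0; case: ifP => _; first by case: (rs0 n./2.+1 m isT m1).
    case: posnP => n0; first by apply: beta0; lia.
    by case: (xy0 _ m n0 m1).
  (* a vanishing t_n would make the positive d_{n+1} vanish *)
  rewrite lt_neqAle t_ge0 andbT eq_sym; apply/eqP => tn0.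
  by have := d0 m n m1; rewrite -td // tn0 mul0r ltxx.
- have t0 m n : (1 <= m <= N)%N -> 0 < t m n.
    by move=> m1; move: n; apply/(tP m m1)/Hbeta.
  have t1 m n : (1 <= m <= N)%N -> 0 < 1 - t m n.+1.
    by move=> m1; rewrite -(pmulr_rgt0 _ (t0 m n m1)) td // d0.
  have tr n m : t m n.*2.+1 = r n.+1 m.
    by rewrite /t /= odd_double /= uphalf_double.
  have tx n m : t m n.*2.+2 = x n.+1 m.
    by rewrite /t /= odd_double /= doubleK.
  split; [split=> [[|m] mN|[//|n] m _ m1]|move=> [//|n] m _ m1].
  + by rewrite beta0E subr_ge0.
  + exact/ltW/(t0 m.+1 0%N).
  + have := t0 m n.*2.+2 m1; have := t1 m n.*2.+1 m1; have := xy1 n.+1 m isT m1.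
    by rewrite tx; lra.
  + have := t0 m n.*2.+1 m1; have := t1 m n.*2 m1; have := rs1 n.+1 m isT m1.
    by rewrite tr; lra.
Qed.
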